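(* The full group $C^*$-algebra $C^*((\mathbb{Z}/2\mathbb{Z})^{*\infty})$ is not singly generated as a $C^*$-algebra.
   Context: For a (discrete) group $G$, $C^*(G)$ denotes its full (universal) $C^*$-algebra. $(\mathbb{Z}/2\mathbb{Z})^{*\infty}$ is the free product of countably infinitely many copies of $\mathbb{Z}/2\mathbb{Z}$. A unital $C^*$-algebra $A$ is singly generated if there is $a\in A$ such that the smallest unital $C^*$-subalgebra of $A$ containing $a$ is $A$. *)

(* Defs.v *)
From HB Require Import structures.
From mathcomp Require Import all_boot all_order all_algebra all_fingroup.
From mathcomp Require Import all_classical all_reals all_analysis.
From mathcomp Require Import complex.

Set Implicit Arguments.
Unset Strict Implicit.
Unset Printing Implicit Defensive.

Import Order.TTheory GRing.Theory Num.Theory.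
Import numFieldNormedType.Exports ComplexField.Normc.

Local Open Scope classical_set_scope.
Local Open Scope ring_scope.

(* Unital C*-algebras over the complex numbers R[i]. The norm is a field of the
   mixin because the library hierarchy has no structure below numDomainType that
   joins rings with normed modules. The zero algebra is excluded since algType
   requires 1 != 0. Nothing below depends on it: maps into the zero algebra are
   unique, and a full group C*-algebra is nonzero because of the one-dimensional
   trivial representation. *)
HB.mixin Record isCStarAlgebra (R : realType) (A : Type)
    of GRing.Algebra R[i] A := {
  star : A -> A;
  cnorm : A -> R;
  starK : forall x, star (star x) = x;
  starD : forall x y, star (x + y) = star x + star y;
  starZ : forall (a : R[i]) x, star (a *: x) = a^* *: star x;
  starM : forall x y, star (x * y) = star y * star x;
  cnorm0_eq0 : forall x, cnorm x = 0 -> x = 0;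
  cnormD : forall x y, cnorm (x + y) <= cnorm x + cnorm y;
  cnormZ : forall (a : R[i]) x, cnorm (a *: x) = normc a * cnorm x;
  cnormM : forall x y, cnorm (x * y) <= cnorm x * cnorm y;
  cnorm_star : forall x, cnorm (star x * x) = cnorm x ^+ 2;
  cnorm_complete : forall s : nat -> A,
    (forall e : R, 0 < e -> exists N : nat, forall m n : nat,
       (N <= m)%N -> (N <= n)%N -> cnorm (s m - s n) < e) ->
    exists l : A, cnorm (s n - l) @[n --> \oo] --> (0 : R)
}.

#[short(type="cstarAlgType")]
HB.structure Definition CStarAlgebra (R : realType) :=
  { A of isCStarAlgebra R A & GRing.Algebra R[i] A }.

(* Unital *-homomorphism; norm continuity is automatic between C*-algebras. *)
Definition star_preserving (R : realType) (A B : cstarAlgType R)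
    (phi : {lrmorphism A -> B}) : Prop :=
  forall x, phi (star x) = star (phi x).

Record unital_cstar_subalgebra (R : realType) (A : cstarAlgType R)
    (S : set A) : Prop := {
  csub_closed : forall (s : nat -> A) (l : A), (forall n, S (s n)) ->
    cnorm (s n - l) @[n --> \oo] --> (0 : R) -> S l;
  csub1 : S 1;
  csubD : forall x y, S x -> S y -> S (x + y);
  csubZ : forall (a : R[i]) x, S x -> S (a *: x);
  csubM : forall x y, S x -> S y -> S (x * y);
  csub_star : forall x, S x -> S (star x)
}.

Definition singly_generated (R : realType) (A : cstarAlgType R) : Prop :=
  exists a : A, smallest (@unital_cstar_subalgebra R A) [set a] = [set: A].

Record unitary_representation (R : realType) (G : groupType)
    (A : cstarAlgType R) (u : G -> A) : Prop := {
  urep1 : u 1%g = 1;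
  urepM : forall g h, u (g * h)%g = u g * u h;
  urep_starl : forall g, star (u g) * u g = 1;
  urep_starr : forall g, u g * star (u g) = 1
}.

(* (A, u) is the full group C*-algebra of the discrete group G: u is the
   universal unitary representation of G in a unital C*-algebra. This
   determines (A, u) up to a unique *-isomorphism. *)
Definition is_full_group_cstar (R : realType) (G : groupType)
    (A : cstarAlgType R) (u : G -> A) : Prop :=
  unitary_representation u /\
  forall (B : cstarAlgType R) (v : G -> B), unitary_representation v ->
    exists phi : {lrmorphism A -> B},
      [/\ star_preserving phi, phi \o u =1 v &
          forall psi : {lrmorphism A -> B},
            star_preserving psi -> psi \o u =1 v -> psi =1 phi].

(* (G, iota) is the free product of the groups F i, i.e. their coproduct in the
   category of (not necessarily finite) groups. *)
Definition is_free_product (I : Type) (F : I -> groupType) (G : groupType)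
    (iota : forall i, UMagmaMorphism.type (F i) G) : Prop :=
  forall (H : groupType) (f : forall i, UMagmaMorphism.type (F i) H),
    exists phi : UMagmaMorphism.type G H,
      (forall i, phi \o iota i =1 f i) /\
      (forall psi : UMagmaMorphism.type G H,
         (forall i, psi \o iota i =1 f i) -> psi =1 phi).

(* Main.v *)
(* Send the free generators to the reflections
   x |-> [[cos, sin], [sin, -cos]](x_i), viewed in the C*-algebra of bounded
   uniformly continuous functions from R^n to the 2 x 2 complex matrices. If a
   single element a generated the full C*-algebra, the matrix-valued function
   image of a would be uniformly continuous, and it would determine every
   reflection uniformly, since the elements b whose image is controlled by that
   of a form a unital C*-subalgebra. As 2 x 2 complex matrices have 8 real
   coordinates, taking n = 9 gives a uniform embedding of the 9-dimensional cube
   in R^8. This is excluded by covering R^8 by 9 families of small bricks, in the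
   manner of Lebesgue's covering theorem, and by a discrete Poincare-Miranda
   theorem, which is proved by evaluating a cup product modulo 2 on a grid. *)

Require Import Defs.
From HB Require Import structures.
From mathcomp Require Import all_boot all_order all_algebra all_fingroup.
From mathcomp Require Import all_classical all_reals all_analysis.
From mathcomp Require Import zify ring lra complex.

Set Implicit Arguments.
Unset Strict Implicit.
Unset Printing Implicit Defensive.

Import Order.TTheory GRing.Theory Num.Theory.
Import numFieldNormedType.Exports ComplexField.Normc.

Local Open Scope classical_set_scope.
Local Open Scope ring_scope.

(** * A discrete Poincare-Miranda theorem *)

Section CubicalCup.
Variable I : eqType.
Implicit Types (v w : I -> nat) (J : seq I) (f : (I -> nat) -> 'F_2).

Definition upd v j t : I -> nat := fun i => if i == j then t else v i.
Definition incr v j := upd v j (v j).+1.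

(* The cup product modulo 2 of the coboundaries of the functions in [fs],
   evaluated on the unit cube with lowest vertex [v] and directions [J]: a sum
   over the monotone edge paths from [v] to the opposite vertex. *)
Fixpoint cup (fs : seq ((I -> nat) -> 'F_2)) J v : 'F_2 :=
  if fs is f :: fs' then
    \sum_(j <- J) (f (incr v j) + f v) * cup fs' [seq i <- J | i != j] (incr v j)
  else 1.

Lemma addF2 (x : 'F_2) : x + x = 0.
Proof. exact: (addrr_pchar2 (pchar_Fp (isT : prime 2))). Qed.

Lemma incrC v i j : incr (incr v i) j = incr (incr v j) i.
Proof.
apply/funext => k; rewrite /incr /upd.
by case: (eqVneq j i) => [->//|ji]; case: (eqVneq k j) => [->|]; rewrite // (negPf ji).
Qed.

Lemma filter_neqC J i j :
  [seq k <- [seq k <- J | k != j] | k != i] = [seq k <- [seq k <- J | k != i] | k != j].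
Proof. by rewrite -!filter_predI; apply: eq_filter => k /=; rewrite andbC. Qed.

(** The terms at [(i, j)] and [(j, i)] agree, so they cancel in pairs modulo 2. *)
Lemma sum_sym2 J (h : I -> I -> 'F_2) : (forall i j, h i j = h j i) ->
  \sum_(j <- J) \sum_(i <- J | i != j) h j i = 0.
Proof.
move=> hC; pose g j i := if i != j then h j i else 0.
have gC i j : g i j = g j i by rewrite /g eq_sym; case: ifP.
under eq_bigr do rewrite big_mkcond.
rewrite -/(\sum_(j <- J) \sum_(i <- J) g j i).
elim: J => [|x J IH]; first by rewrite big_nil.
under eq_bigr do rewrite big_cons.
rewrite big_split /= big_cons [X in _ + X]big_cons IH addr0.
under eq_bigr do rewrite gC.
by rewrite -addrA addF2 addr0 /g eqxx.
Qed.

Lemma sum_neqC J (h : I -> I -> 'F_2) :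
  \sum_(j <- J) \sum_(i <- J | i != j) h j i =
  \sum_(j <- J) \sum_(i <- J | i != j) h i j.
Proof.
rewrite (exchange_big_dep xpredT) //=.
by apply: eq_bigr => i _; apply: eq_bigl => j; rewrite eq_sym.
Qed.

Lemma size_filter_neq J j : uniq J -> j \in J ->
  size [seq i <- J | i != j] = (size J).-1.
Proof. by move=> uJ jJ; rewrite -rem_filter // size_rem. Qed.

(* [cup fs] is a cocycle: its sum over the boundary of a cube vanishes. *)
Lemma cup_closed fs J v : uniq J -> size J = (size fs).+1 ->
  \sum_(j <- J) (cup fs [seq i <- J | i != j] (incr v j) +
                 cup fs [seq i <- J | i != j] v) = 0.
Proof.
elim: fs J v => [|f fs IH] J v uJ sJ.
  by apply: big1_seq => j _ /=; exact: addF2.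
(* The induction hypothesis on the cube at [w] without direction [j]: its far faces and its near
   faces contribute equally. *)
have IHj j w : j \in J ->
    \sum_(i <- J | i != j)
       cup fs [seq k <- [seq k <- J | k != j] | k != i] (incr w i) =
    \sum_(i <- J | i != j)
       cup fs [seq k <- [seq k <- J | k != j] | k != i] w.
  move=> jJ; apply/eqP; rewrite -subr_eq0 -sumrB; apply/eqP.
  rewrite -[RHS](IH [seq k <- J | k != j] w) ?filter_uniq //; last first.
    by rewrite size_filter_neq // sJ.
  rewrite big_filter; apply: eq_bigr => i _; congr (_ + _).
  by apply/eqP; rewrite eq_sym -subr_eq0 opprK addF2.
pose P j i w := cup fs [seq k <- [seq k <- J | k != j] | k != i] w.
have PC j i w : P j i w = P i j w by rewrite /P filter_neqC.
rewrite big_split /=.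
under eq_bigr do rewrite big_filter.
under [X in _ + X]eq_bigr do rewrite big_filter.
rewrite -/(P _ _).
(* The terms with [f] at the twice incremented vertex are symmetric in [i] and [j] and cancel; in
   the others [IHj] moves [P] back to [incr v j]. *)
have -> : \sum_(j <- J) \sum_(i <- J | i != j)
     (f (incr (incr v j) i) + f (incr v j)) * P j i (incr (incr v j) i) =
   \sum_(j <- J) \sum_(i <- J | i != j) f (incr v j) * P j i (incr v j).
  under eq_bigr do (under eq_bigr do rewrite mulrDl; rewrite big_split /=).
  rewrite big_split /= sum_sym2 ?add0r => [|i j]; last by rewrite incrC PC.
  apply: eq_big_seq => j jJ.
  by rewrite -!mulr_sumr IHj.
(* The terms with factor [f v] cancel, because [IHj] moves [P] to [v], where it is symmetric;
   exchanging [i] and [j] in the others gives the same sum as before. *)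
have -> : \sum_(j <- J) \sum_(i <- J | i != j)
     (f (incr v i) + f v) * P j i (incr v i) =
   \sum_(j <- J) \sum_(i <- J | i != j) f (incr v j) * P j i (incr v j).
  under eq_bigr do (under eq_bigr do rewrite mulrDl; rewrite big_split /=).
  rewrite big_split /= [X in _ + X = _](_ : _ = 0) ?addr0.
    rewrite [LHS]sum_neqC; apply: eq_bigr => j _; apply: eq_bigr => i _.
    by rewrite PC.
  transitivity (f v * \sum_(j <- J) \sum_(i <- J | i != j) P j i v); last first.
    by rewrite sum_sym2 ?mulr0.
  rewrite mulr_sumr; apply: eq_big_seq => j jJ.
  by rewrite -!mulr_sumr IHj.
exact: addF2.
Qed.

(* Hence the next cup product is a sum of differences along the axes, which
   telescopes when it is summed over a box. *)
Lemma cup_cons f fs J v : uniq J -> size J = (size fs).+1 ->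
  cup (f :: fs) J v =
  \sum_(j <- J) (f (incr v j) * cup fs [seq i <- J | i != j] (incr v j) +
                 f v * cup fs [seq i <- J | i != j] v).
Proof.
move=> uJ sJ /=.
under eq_bigr do rewrite mulrDl.
rewrite !big_split /=; congr (_ + _); rewrite -!mulr_sumr; congr (_ * _).
(* It remains that far and near faces have equal totals, which is [cup_closed]. *)
apply/eqP; rewrite -subr_eq0 -sumrB; apply/eqP.
rewrite -[RHS](cup_closed v uJ sJ); apply: eq_bigr => i _; congr (_ + _).
by apply/eqP; rewrite eq_sym -subr_eq0 opprK addF2.
Qed.

(** Every path in the cup product contributes a factor that is the difference of [f] along an edge
    of the cube, hence 0. *)
Lemma cup_const fs J v f (c : 'F_2) : f \in fs ->
  (forall w, (forall i, (v i <= w i <= v i + (i \in J))%N) -> f w = c) ->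
  cup fs J v = 0.
Proof.
have incr_cube j w : j \in J ->
    (forall i, (incr v j i <= w i <= incr v j i + (i \in [seq i <- J | i != j]))%N) ->
    forall i, (v i <= w i <= v i + (i \in J))%N.
  move=> jJ wP i; move: (wP i); rewrite mem_filter /incr /upd.
  by case: eqVneq => [->|ij] //=; rewrite jJ addn0 addn1 => /andP[/ltnW-> ->].
elim: fs J v incr_cube => [//|g fs IH] J v incr_cube.
rewrite inE => /predU1P[<-|ffs] fc /=; apply: big1_seq => j /= jJ.
  rewrite !fc ?addF2 ?mul0r // => i; first by rewrite leqnn leq_addr.
  by rewrite /incr /upd; case: eqVneq => [->|_]; rewrite ?jJ ?addn1 leqnn ?leqnSn ?leq_addr.
rewrite (IH _ (incr v j)) ?mulr0 // => [k w|w /(incr_cube _ _ jJ)/fc//].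
rewrite mem_filter => /andP[kj kJ] wP i; move: (wP i).
rewrite !mem_filter /incr /upd; case: (eqVneq i k) => [->|ik] /=.
  by rewrite (negPf kj) kJ addn0 addn1 => /andP[/ltnW-> ->].
by [].
Qed.

(** * Sums over the cells of a grid, and telescoping *)

Definition boxsum m (js : seq I) (g : (I -> nat) -> 'F_2) : (I -> nat) -> 'F_2 :=
  foldr (fun j h v => \sum_(t < m) h (upd v j t)) g js.

Lemma updC v i j s t : i != j -> upd (upd v i s) j t = upd (upd v j t) i s.
Proof.
move=> ij; apply/funext => k; rewrite /upd.
by case: (eqVneq k j) => // ->; rewrite eq_sym (negPf ij).
Qed.

Lemma boxsum_upd m js g v j t : j \notin js ->
  boxsum m js (fun w => g (upd w j t)) v = boxsum m js g (upd v j t).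
Proof.
elim: js v => [//|i js IH] v; rewrite inE negb_or => /andP[ji jjs] /=.
by apply: eq_bigr => s _; rewrite IH // updC // eq_sym.
Qed.

Lemma eq_boxsum m js g h v : g =1 h -> boxsum m js g v = boxsum m js h v.
Proof. by move=> /funext->. Qed.

Lemma boxsum_sum m js (T : Type) (r : seq T) (g : T -> (I -> nat) -> 'F_2) v :
  boxsum m js (fun w => \sum_(t <- r) g t w) v = \sum_(t <- r) boxsum m js (g t) v.
Proof.
elim: js v => [//|i js IH] v /=; rewrite exchange_big /=.
by apply: eq_bigr => s _; rewrite IH.
Qed.

Lemma boxsum_eq0 m js g v : (forall w, g w = 0) -> boxsum m js g v = 0.
Proof.
by move=> g0; elim: js v => [//|i js IH] v /=; apply: big1 => t _; exact: IH.
Qed.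

Lemma boxsum_rem m js g v j : uniq js -> j \in js ->
  boxsum m js g v =
  boxsum m [seq i <- js | i != j] (fun w => \sum_(t < m) g (upd w j t)) v.
Proof.
elim: js v => [//|i js IH] v /= /andP[ijs ujs]; rewrite inE eq_sym.
case: eqVneq => [<- _|ij /= jjs] /=; last by apply: eq_bigr => t _; rewrite IH.
rewrite (_ : [seq k <- js | k != i] = js); last first.
  by apply/all_filterP/allP => k kjs; apply: contraNneq ijs => <-.
rewrite boxsum_sum; apply: eq_bigr => t _.
by rewrite boxsum_upd.
Qed.

(** The sum along the axis [j] telescopes to the two end faces, whose signs agree modulo 2. *)
Lemma boxsum_diff m js g v j : uniq js -> j \in js ->
  boxsum m js (fun w => g (incr w j) + g w) v =
  boxsum m [seq i <- js | i != j] (fun w => g (upd w j m) + g (upd w j 0)) v.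
Proof.
move=> ujs jjs; rewrite (boxsum_rem _ _ _ ujs jjs); apply: eq_boxsum => w.
have incrE t : incr (upd w j t) j = upd w j t.+1.
  by apply/funext => k; rewrite /incr /upd eqxx; case: eqP.
under eq_bigr do rewrite incrE.
elim: m => [|m IH]; first by rewrite big_ord0 addF2.
rewrite big_ord_recr /= IH addrC -addrA; congr (_ + _).
by rewrite addrA addF2 add0r.
Qed.

(** Induction on the dimension. By [cup_cons] and telescoping only faces of the box contribute. Of
    the faces across [j0], the far one carries the lower-dimensional cup product and the near one
    gives 0; the faces across the other axes give 0. *)
Lemma boxsum_cup m js (f : I -> (I -> nat) -> 'F_2) v : uniq js ->
  (forall j w, j \in js -> w j = 0%N -> f j w = 0) ->
  (forall j w, j \in js -> w j = m -> f j w = 1) ->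
  boxsum m js (cup (map f js) js) v = 1.
Proof.
elim: js v => [//|j0 js IH] v ujs f0 f1.
have /andP[j0js ujs'] := ujs.
pose G j w := f j0 w * cup [seq f j | j <- js] [seq i <- j0 :: js | i != j] w.
transitivity (\sum_(j <- j0 :: js)
    boxsum m (j0 :: js) (fun w => G j (incr w j) + G j w) v).
  rewrite -boxsum_sum; apply: eq_boxsum => w.
  by rewrite map_cons cup_cons ?size_map.
have jsE : [seq k <- js | k != j0] = js.
  by apply/all_filterP/allP => k kjs; apply: contraNneq j0js => <-.
have updE w j t : upd w j t j = t by rewrite /upd eqxx.
rewrite big_cons [X in _ + X]big1_seq ?addr0 => [|j /andP[_ jjs]].
  rewrite (boxsum_diff _ (G j0)) ?mem_head //= eqxx /= jsE.
  rewrite (eq_boxsum _ _ _ (h := fun w => cup [seq f j | j <- js] js (upd w j0 m))).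
    rewrite boxsum_upd // IH // => j w jjs; [apply: f0|apply: f1];
      by rewrite inE jjs orbT.
  move=> w; rewrite /G /= eqxx /= jsE f1 ?mem_head // f0 ?mem_head //.
  by rewrite mul0r addr0 mul1r.
have jJ : j \in j0 :: js by rewrite inE jjs orbT.
(* The cells of a face across [j] do not extend in direction [j], so [f j], still a factor of the
   cup product, is constant on them. *)
have z t c w : (forall w, w j = t -> f j w = c) -> G j (upd w j t) = 0.
  move=> fc; rewrite /G (@cup_const _ _ _ (f j) c) ?mulr0 //; first exact: map_f.
  move=> w' w'P; apply: fc; move: (w'P j).
  by rewrite mem_filter eqxx /= addn0 updE -eqn_leq => /eqP.
rewrite (boxsum_diff _ (G j)) //; apply: boxsum_eq0 => w.
rewrite (z m 1) => [|w' w'j]; last exact: f1.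
by rewrite (z 0%N 0) ?addr0 // => w' w'j; exact: f0.
Qed.

End CubicalCup.

(** The cup product has total 1 over the grid, so it is nonzero on some cell, and by [cup_const] no
    [f j] with [j] in [js] is constant there. *)
Lemma cube_nonconst (I : eqType) m (js : seq I) (f : I -> (I -> nat) -> bool) :
  uniq js ->
  (forall j w, j \in js -> w j = 0%N -> f j w = false) ->
  (forall j w, j \in js -> w j = m -> f j w = true) ->
  exists v : I -> nat, forall j, j \in js -> exists p q : I -> nat,
    [/\ f j p, ~~ f j q,
      (forall i, v i <= p i <= (v i).+1)%N & (forall i, v i <= q i <= (v i).+1)%N].
Proof.
move=> ujs f0 f1; pose g j w : 'F_2 := (f j w)%:R.
have box1 : boxsum m js (cup (map g js) js) (fun=> 0%N) = 1.
  apply: boxsum_cup => // j w jjs wj; rewrite /g; first by rewrite f0.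
  by rewrite f1.
have [v cv] : exists v, cup (map g js) js v != 0.
  apply/not_existsP => cup0; move: (oner_neq0 'F_2); apply/negP/negPn/eqP.
  by rewrite -box1 boxsum_eq0 // => w; apply/eqP/negPn/negP; exact: cup0.
exists v => j jjs.
pose Q w := forall i, (v i <= w i <= (v i).+1)%N.
have nc b : exists2 p, f j p = b & Q p.
  apply: contrapT => H; move/eqP: cv; apply.
  apply: (@cup_const _ _ _ _ (g j) (~~ b)%:R); first exact: map_f.
  move=> w wv; rewrite /g; congr (_%:R); apply: contrapT => fw.
  apply: H; exists w; first by case: b fw; case: (f j w).
  move=> i; have /andP[-> /leq_trans] /= := wv i; apply.
  by rewrite -addn1 leq_add2l; case: (_ \in _).
have [p fp Qp] := nc true; have [q fq Qq] := nc false.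
by exists p, q; split => //; rewrite ?fq.
Qed.

(** * Non-embedding of cubes *)

Lemma floor_cross (R : realType) (s t : R) : Num.floor s != Num.floor t ->
  exists n : int, (s < n%:~R <= t) || (t < n%:~R <= s).
Proof.
have H (a b : R) : Num.floor a < Num.floor b -> a < (Num.floor b)%:~R <= b.
  by rewrite floor_lt_int => ->; rewrite ge_floor.
by rewrite neq_lt => /orP[/H h|/H h]; [exists (Num.floor t)|exists (Num.floor s)];
  rewrite h ?orbT.
Qed.

(* A function whose oscillation is less than [1 / K] crosses the lattice
   [c / K + Z] for at most one class [c] modulo [K]. *)
Lemma floor_cross_inj (R : realType) K (c c' : 'I_K) (T : Type) (Q : T -> Prop)
    (g : T -> R) (p q p' q' : T) :
  Q p -> Q q -> Q p' -> Q q' ->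
  (forall x y, Q x -> Q y -> `|g x - g y| < K%:R^-1) ->
  Num.floor (g p - c%:R / K%:R) != Num.floor (g q - c%:R / K%:R) ->
  Num.floor (g p' - c'%:R / K%:R) != Num.floor (g q' - c'%:R / K%:R) ->
  c = c'.
Proof.
move=> Qp Qq Qp' Qq' osc.
have K0 : 0 < K%:R :> R by rewrite ltr0n; case: (K) c => // -[].
have cross (d : 'I_K) r s : Q r -> Q s ->
    Num.floor (g r - d%:R / K%:R) != Num.floor (g s - d%:R / K%:R) ->
    exists (n : int) r s, [/\ Q r, Q s, g r * K%:R < n%:~R * K%:R + d%:R &
                         n%:~R * K%:R + d%:R <= g s * K%:R].
  move=> Qr Qs /floor_cross[n nrs]; exists n.
  have E (a : R) : (a * K%:R < n%:~R * K%:R + d%:R) = (a - d%:R / K%:R < n%:~R).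
    by rewrite [RHS]ltrBlDr -[RHS](ltr_pM2r K0) mulrDl divfK ?gt_eqF.
  have E' (a : R) : (n%:~R * K%:R + d%:R <= a * K%:R) = (n%:~R <= a - d%:R / K%:R).
    by rewrite [RHS]lerBrDr -[RHS](ler_pM2r K0) mulrDl divfK ?gt_eqF.
  by case/orP: nrs => /andP[h1 h2]; [exists r, s|exists s, r]; rewrite E E'.
move=> /(cross _ _ _ Qp Qq)[n [r [s [Qr Qs h1 h2]]]].
move=> /(cross _ _ _ Qp' Qq')[n' [r' [s' [Qr' Qs' h1' h2']]]].
(* After scaling by [K], the crossed points [n * K + c] and [n' * K + c'] are integers at distance
   less than 1, hence equal; both classes being below [K], they coincide. *)
have oscK x y : Q x -> Q y -> g x * K%:R - g y * K%:R < 1.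
  move=> Qx Qy; rewrite -mulrBl -(ltr_pdivlMr _ _ K0) mul1r.
  by apply: le_lt_trans (osc _ _ Qx Qy); exact: ler_norm.
have lt1 (z : int) : z%:~R < 1 :> R -> z < 1 by rewrite -(ltr_int R).
have A : (n * K%:Z + c%:Z) - (n' * K%:Z + c'%:Z) < 1.
  apply: lt1; rewrite !(rmorphB, rmorphD, rmorphM) /= -!pmulrn.
  by have := oscK _ _ Qs Qr'; lra.
have A' : (n' * K%:Z + c'%:Z) - (n * K%:Z + c%:Z) < 1.
  apply: lt1; rewrite !(rmorphB, rmorphD, rmorphM) /= -!pmulrn.
  by have := oscK _ _ Qs' Qr; lra.
apply/val_inj => /=; have := ltn_ord c; have := ltn_ord c' => cK' cK.
have : (n = n' \/ n + 1 <= n' \/ n' + 1 <= n)%R by lia.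
by case=> [nn|[nn|nn]]; nia.
Qed.

(* The bricks of colour [c] are the cubes of side [e] with corners in
   [e (c / K + Z) ^ k], where [K = k + 1]. A small cube meets two bricks of
   colour [c] only if one of its [k] coordinates crosses [e (c / K + Z)], which
   for each coordinate happens for at most one colour. *)
Lemma no_uniform_embedding (R : realType) k (F : ('I_k.+1 -> R) -> 'I_k -> R) :
  (forall e, 0 < e -> exists2 d, 0 < d & forall x y : 'I_k.+1 -> R,
     (forall c, `|x c - y c| <= d) -> forall j, `|F x j - F y j| <= e) ->
  ~ (exists2 e, 0 < e & forall x y : 'I_k.+1 -> R,
     (forall j, `|F x j - F y j| <= e) -> forall c, x c = 0 -> y c = 1 -> False).
Proof.
move=> Fu [e e0 Fi].
set K := k.+1; have K0 : 0 < K%:R :> R by rewrite ltr0n.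
(* The factor 2 makes the oscillation of [F / e] on a cell strictly less than [1 / K]; the mesh
   [1 / m] is taken below [d]. *)
have [|d d0 Fd] := Fu (e / (2 * K%:R)); first by rewrite divr_gt0 // mulr_gt0.
have [m dm] : exists m : nat, d^-1 < m%:R by exists (Num.truncn d^-1).+1; exact: truncnS_gt.
have m0 : 0 < m%:R :> R by apply: lt_trans dm; rewrite invr_gt0.
pose pt (v : 'I_K -> nat) : 'I_K -> R := fun c => (v c)%:R / m%:R.
pose g j v := F (pt v) j / e.
pose brick (c : 'I_K) j v := Num.floor (g j v - c%:R / K%:R).
(* [f c v] fails when the brick of colour [c] containing the image of [v] also contains the image of
   a point of the face [v' c = 0]. Bricks have side [e], so by [Fi] this cannot happen on the
   opposite face. *)
pose f c v := ~~ `[< exists2 v', v' c = 0%N & forall j, brick c j v' = brick c j v >].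
have brick_close c v v' : (forall j, brick c j v' = brick c j v) ->
    forall j, `|F (pt v') j - F (pt v) j| <= e.
  move=> b j; suff: `|g j v' - g j v| <= 1.
    by rewrite -mulrBl normrM normfV (gtr0_norm e0) ler_pdivrMr // mul1r.
  have := b j; rewrite /brick => /esym/eqP; rewrite floor_eq.
  have := floor_itv (g j v - c%:R / K%:R) => /andP[a1 a2].
  have := floor_itv (g j v' - c%:R / K%:R) => /andP[a3 a4].
  rewrite intrD in a2 a4.
  rewrite intrD => /andP[a5 a6].
  by rewrite ler_norml; apply/andP; split; lra.
have [] := @cube_nonconst _ m (enum 'I_K) f (enum_uniq _).
- move=> j w _ wj; apply/negbTE; rewrite negbK; apply/asboolP; by exists w.
- move=> j w _ wj; apply/negP => /asboolP[w' w'0 /brick_close/Fi/(_ j)]; apply.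
    by rewrite /pt w'0 mul0r.
  by rewrite /pt wj divff // gt_eqF.
move=> v fv.
pose Q p := forall i, (v i <= p i <= (v i).+1)%N.
have Qg j p q : Q p -> Q q -> `|g j p - g j q| < K%:R^-1.
  move=> Qp Qq; rewrite -mulrBl normrM normfV (gtr0_norm e0) ltr_pdivrMr //.
  apply: (@le_lt_trans _ _ (e / (2 * K%:R))).
    apply: Fd => c; rewrite /pt -mulrBl normrM normfV (gtr0_norm m0) ler_pdivrMr //.
    apply: (@le_trans _ _ 1).
      rewrite ler_distl lerBlDr !natr1 !ler_nat.
      move/(_ c)/andP: Qp => [p1 p2]; move/(_ c)/andP: Qq => [q1 q2].
      by rewrite (leq_trans q2) ?(leq_trans p2) ?ltnS.
    by rewrite mulrC -ler_pdivrMr // div1r ltW.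
  by rewrite invfM mulrA mulrC ltr_pM2l ?invr_gt0 // ltr_pdivrMr //; lra.
(* Where [f c] changes value the brick changes too, so some coordinate [J c] crosses the lattice of
   colour [c]. *)
have /choice[J JP] : forall c, exists j, exists p q,
    [/\ Q p, Q q & brick c j p != brick c j q].
  move=> c; have [p [q [fp fq Qp Qq]]] := fv c (mem_enum _ c).
  apply: contrapT => H; move: fp fq; rewrite /f negbK => /negP fp /asboolP[v' v'0 v'q].
  apply: fp; apply/asboolP; exists v' => // j; rewrite v'q.
  by apply: contrapT => /eqP b; apply: H; exists j, q, p.
have Jinj : injective J.
  move=> c c' Jcc'; have [p [q [Qp Qq bpq]]] := JP c.
  have [p' [q' [Qp' Qq' bpq']]] := JP c'.
  rewrite -Jcc' in bpq'.
  by apply: (floor_cross_inj Qp Qq Qp' Qq' _ bpq bpq') => x y; exact: Qg.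
(* Pigeonhole: [J] would inject [k + 1] colours into [k] coordinates. *)
by have := max_card (mem (codom J)); rewrite card_codom // !card_ord ltnn.
Qed.

(** * Operator bounds for 2 x 2 complex matrices *)

Section OperatorBound.
Variable R : realType.
Local Notation C := R[i].
Implicit Types (M N : 'M[C]_2) (u v : 'cV[C]_2) (c : R).

Lemma ler_normcD (y z : C) : normc (y + z) <= normc y + normc z.
Proof. exact: le_normcD. Qed.

Lemma normc_ge0 (z : C) : 0 <= normc z.
Proof. by case: z => a b; exact: sqrtr_ge0. Qed.

Lemma normc_norm (z : C) : (normc z)%:C%C = `|z|.
Proof. by []. Qed.

Lemma normc_conj (z : C) : normc z^* = normc z.
Proof. by apply: (@complexI R); rewrite !normc_norm norm_conjC. Qed.

Lemma mul_conj_normc (z : C) : z^* * z = (normc z ^+ 2)%:C%C.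
Proof. by rewrite rmorphXn /= normc_norm normCK mulrC. Qed.

Lemma normcr (a : R) : normc a%:C%C = `|a|.
Proof. by rewrite /normc /= expr0n addr0 sqrtr_sqr. Qed.

Lemma le_normc_Re (z : C) : `|complex.Re z| <= normc z.
Proof. by have := normc_ge_Re z; rewrite -normc_norm lecR. Qed.

Lemma le_normc_Im (z : C) : `|complex.Im z| <= normc z.
Proof.
case: z => a b; rewrite /normc /= -sqrtr_sqr ler_wsqrtr // lerDr sqr_ge0 //.
Qed.

Lemma normc_le_ReIm (z : C) : normc z <= `|complex.Re z| + `|complex.Im z|.
Proof.
case: z => a b; have -> : (a +i* b)%C = a%:C%C + (0 +i* b)%C :> C.
  by apply/eqP; rewrite eq_complex /= add0r addr0 !eqxx.
apply: le_trans (ler_normcD _ _) _ ; rewrite normcr /= addr0 add0r lerD2l.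
by rewrite expr0n add0r sqrtr_sqr.
Qed.

Definition adj m n (M : 'M[C]_(m, n)) : 'M[C]_(n, m) := (map_mx Num.conj M)^T.

Lemma adjM m n p (M : 'M[C]_(m, n)) (N : 'M[C]_(n, p)) :
  adj (M *m N) = adj N *m adj M.
Proof. by rewrite /adj map_mxM trmx_mul. Qed.

Lemma adjK m n : cancel (@adj m n) (@adj n m).
Proof. by move=> M; apply/matrixP => i j; rewrite !mxE conjCK. Qed.

Lemma adjD m n (M N : 'M[C]_(m, n)) : adj (M + N) = adj M + adj N.
Proof. by apply/matrixP => i j; rewrite !mxE rmorphD. Qed.

Lemma adjZ m n a (M : 'M[C]_(m, n)) : adj (a *: M) = a^* *: adj M.
Proof. by apply/matrixP => i j; rewrite !mxE rmorphM. Qed.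

Lemma adjB m n (M N : 'M[C]_(m, n)) : adj (M - N) = adj M - adj N.
Proof. by apply/matrixP => i j; rewrite !mxE rmorphB. Qed.

Definition dot u v : C := (adj u *m v) 0 0.
Definition vnorm u : R := Num.sqrt (normc (u 0 0) ^+ 2 + normc (u 1 0) ^+ 2).

Lemma dot_adj M u v : dot u (M *m v) = dot (adj M *m u) v.
Proof. by rewrite /dot adjM adjK mulmxA. Qed.

Lemma dotE u v : dot u v = (u 0 0)^* * v 0 0 + (u 1 0)^* * v 1 0.
Proof.
rewrite /dot mxE !big_ord_recl big_ord0 addr0 !mxE.
by rewrite (_ : lift ord0 ord0 = 1) //; exact/val_inj.
Qed.

Lemma vnorm_ge0 u : 0 <= vnorm u. Proof. exact: sqrtr_ge0. Qed.

Lemma dotvv u : dot u u = (vnorm u ^+ 2)%:C%C.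
Proof.
by rewrite dotE !mul_conj_normc -rmorphD /= /vnorm sqr_sqrtr // addr_ge0 ?sqr_ge0.
Qed.

Lemma dotC u v : dot v u = (dot u v)^*.
Proof. by rewrite !dotE rmorphD !rmorphM /= !conjCK; congr (_ + _); rewrite mulrC. Qed.

(** Cauchy-Schwarz, from the square of [a * d - b * c]. *)
Lemma normc_dot u v : normc (dot u v) <= vnorm u * vnorm v.
Proof.
rewrite dotE; apply: le_trans (ler_normcD _ _) _; rewrite !normcM !normc_conj.
rewrite /vnorm -sqrtrM ?addr_ge0 ?sqr_ge0 //.
set a := normc _; set b := normc _; set c := normc _; set d := normc _.
rewrite -[leLHS]ger0_norm -?sqrtr_sqr ?ler_wsqrtr ?addr_ge0 ?mulr_ge0 ?normc_ge0 //.
by have := sqr_ge0 (a * d - b * c); nra.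
Qed.

Lemma vnorm_entry u i : normc (u i 0) <= vnorm u.
Proof.
rewrite -[leLHS]ger0_norm ?normc_ge0 // -sqrtr_sqr ler_wsqrtr //.
have : i = 0 \/ i = 1 by case: i => -[|[|//]] h; [left|right]; exact/val_inj.
by case=> ->; rewrite ?lerDl ?lerDr sqr_ge0.
Qed.

(** An upper bound on the operator norm, phrased with the sesquilinear form so that passing to the
    adjoint only exchanges the two vectors. *)
Definition opbound c M := forall u v,
  normc (dot u (M *m v)) <= c * (vnorm u * vnorm v).

Lemma opbound_le c c' M : c <= c' -> opbound c M -> opbound c' M.
Proof.
move=> cc' cM u v; apply: le_trans (cM u v) _.
by rewrite ler_wpM2r // mulr_ge0 ?vnorm_ge0.
Qed.

(** Taking [d] divided by [vnorm u * vnorm v + 1] keeps the excess below any given [d]; the 1 guards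
    against a zero denominator. *)
Lemma opbound_small c (M : 'M[C]_2) : (forall d, 0 < d -> opbound (c + d) M) -> 
  opbound c M.
Proof.
move=> cM u v; apply/ler_addgt0Pr => d d0.
have q0 : 0 <= vnorm u * vnorm v by rewrite mulr_ge0 ?vnorm_ge0.
apply: le_trans (cM (d / (vnorm u * vnorm v + 1)) _ u v) _.
  by rewrite divr_gt0 // ltr_wpDl.
rewrite mulrDl lerD2l -mulrA ger_pMr // mulrC ler_pdivrMr ?mul1r ?lerDl //.
by rewrite ltr_wpDl.
Qed.

Lemma opbound1 : opbound 1 1.
Proof. by move=> u v; rewrite mul1mx mul1r; exact: normc_dot. Qed.

Lemma opbound0 : opbound 0 0.
Proof.
by move=> u v; rewrite mul0mx mul0r dotE !mxE !mulr0 addr0 normc0.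
Qed.

Lemma dotDr u v w : dot u (v + w) = dot u v + dot u w.
Proof. by rewrite /dot mulmxDr mxE. Qed.

Lemma dotZr u a v : dot u (a *: v) = a * dot u v.
Proof. by rewrite /dot -scalemxAr mxE. Qed.

Lemma opboundD c d M N : opbound c M -> opbound d N -> opbound (c + d) (M + N).
Proof.
move=> cM dN u v; rewrite mulmxDl dotDr mulrDl.
by apply: le_trans (ler_normcD _ _) _; exact: lerD.
Qed.

Lemma opboundZ c a M : opbound c M -> opbound (normc a * c) (a *: M).
Proof.
move=> cM u v; rewrite -scalemxAl dotZr normcM -mulrA.
by rewrite ler_wpM2l ?normc_ge0.
Qed.

Lemma opboundN c M : opbound c M -> opbound c (- M).
Proof.
by move=> /(opboundZ (-1)); rewrite scaleN1r normcN normc1 mul1r.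
Qed.

Lemma opboundB c d M N : opbound c M -> opbound d N -> opbound (c + d) (M - N).
Proof. by move=> cM /opboundN; exact: opboundD. Qed.

Lemma opbound_adj c M : opbound c M -> opbound c (adj M).
Proof.
move=> cM u v; rewrite dot_adj adjK dotC normc_conj [vnorm u * _]mulrC.
exact: cM.
Qed.

Lemma vnorm_bound c M v : 0 <= c -> opbound c M -> vnorm (M *m v) <= c * vnorm v.
Proof.
move=> c0 cM; have := cM (M *m v) v; rewrite dotvv normcr normrX ger0_norm ?vnorm_ge0 //.
have := vnorm_ge0 (M *m v); rewrite le0r => /predU1P[->|w0].
  by rewrite mulr_ge0 ?vnorm_ge0.
by rewrite expr2 mulrCA ler_pM2l.
Qed.

Lemma opboundM c d M N : 0 <= c -> 0 <= d -> opbound c M -> opbound d N ->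
  opbound (c * d) (M * N).
Proof.
move=> c0 d0 cM dN u v; rewrite -mulmxA.
apply: le_trans (cM _ _) _; rewrite -mulrA ler_wpM2l // mulrCA.
by rewrite ler_wpM2l ?vnorm_ge0 // vnorm_bound.
Qed.

(** The squared norm of [M *m v] is the form of [adj M * M] at [v]. This gives the hard half of the
    C*-identity. *)
Lemma opbound_sqrt c M : 0 <= c -> opbound c (adj M * M) ->
  opbound (Num.sqrt c) M.
Proof.
move=> c0 cM u v; apply: le_trans (normc_dot _ _) _.
rewrite mulrCA ler_wpM2l ?vnorm_ge0 //.
rewrite -[leLHS]ger0_norm ?vnorm_ge0 // -sqrtr_sqr -[vnorm v]ger0_norm ?vnorm_ge0 //.
rewrite -sqrtr_sqr -sqrtrM // ler_wsqrtr //.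
have := cM v v; rewrite -[_ * M]/(_ *m M) -mulmxA dot_adj adjK dotvv normcr normrX.
by rewrite ger0_norm ?vnorm_ge0.
Qed.

Lemma dot_delta M i j : dot (delta_mx i 0) (M *m delta_mx j 0) = M i j.
Proof.
rewrite /dot /adj map_delta_mx trmx_delta -rowE -colE !mxE //.
Qed.

Lemma vnorm_delta i : vnorm (delta_mx i 0) = 1.
Proof.
suff: vnorm (delta_mx i 0) ^+ 2 = 1.
  move/eqP; rewrite sqrf_eq1 => /predU1P[//|/eqP e].
  by have := vnorm_ge0 (delta_mx i 0); rewrite e; lra.
apply: (@complexI R); rewrite -dotvv.
by rewrite -[X in dot _ X]mul1mx dot_delta mxE eqxx.
Qed.

Lemma opbound_entry c M i j : opbound c M -> normc (M i j) <= c.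
Proof.
by move=> /(_ (delta_mx i 0) (delta_mx j 0)); rewrite dot_delta !vnorm_delta !mulr1.
Qed.

(** The form is a sum of four terms, one for each entry. *)
Lemma entry_opbound c M : (forall i j, normc (M i j) <= c) -> opbound (4 * c) M.
Proof.
move=> cM u v.
have e a b : normc ((u a 0)^* * (M a b * v b 0)) <= c * (vnorm u * vnorm v).
  rewrite !normcM normc_conj mulrCA ler_pM ?mulr_ge0 ?normc_ge0 //.
  by rewrite ler_pM ?normc_ge0 ?vnorm_entry.
have lift1 : lift ord0 ord0 = 1 :> 'I_2 by exact/val_inj.
rewrite dotE !mxE !big_ord_recl !big_ord0 !addr0 !lift1 !mulrDr.
rewrite (_ : 4 * c * _ = (c * (vnorm u * vnorm v) + c * (vnorm u * vnorm v))
   + (c * (vnorm u * vnorm v) + c * (vnorm u * vnorm v))); last by ring.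
do ![apply: le_trans (ler_normcD _ _) _; apply: lerD]; exact: e.
Qed.

End OperatorBound.

(** * The C*-algebra of bounded uniformly continuous functions *)

Section FunctionAlgebra.
Variables (T : pointedType) (K : pzRingType) (V : algType K).

Let scaleAl (k : K) (f g : T -> V) : k *: (f * g) = k *: f * g.
Proof. by apply/funext => x /=; rewrite /GRing.mul /GRing.scale /= scalerAl. Qed.

HB.instance Definition _ := GRing.Lmodule_isLalgebra.Build K (T -> V) scaleAl.

Let scaleAr (k : K) (f g : T -> V) : k *: (f * g) = f * (k *: g).
Proof. by apply/funext => x /=; rewrite /GRing.mul /GRing.scale /= scalerAr. Qed.

HB.instance Definition _ := GRing.Lalgebra_isAlgebra.Build K (T -> V) scaleAr.
End FunctionAlgebra.

(* [E d x y] reads: x and y are d-close. It stands both for closeness in R^n and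
   for closeness of the values of a given function. *)
Section ControlledContinuity.
Variables (R : realType) (X : Type) (E : R -> X -> X -> Prop).
Hypothesis E_le : forall d d' x y, d <= d' -> E d x y -> E d' x y.
Local Notation C := R[i].
Implicit Types f g : X -> 'M[C]_2.

Definition bounded_by f (c : R) := forall x, opbound c (f x).

(** Uniform continuity when [E] is closeness of points; when [E] is closeness of the values of a
    function, uniform dependence on that function. *)
Definition controlled f := forall e, 0 < e -> exists2 d, 0 < d &
  forall x y, E d x y -> opbound e (f x - f y).

Lemma controlled_cst (M : 'M[C]_2) : controlled (cst M).
Proof.
move=> e e0; exists 1 => // x y _; rewrite subrr.
exact: opbound_le (ltW e0) (@opbound0 R).
Qed.

Lemma controlled2 f g e e' : controlled f -> controlled g -> 0 < e -> 0 < e' ->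
  exists2 d, 0 < d & forall x y, E d x y ->
    opbound e (f x - f y) /\ opbound e' (g x - g y).
Proof.
move=> fc gc e0 e'0; have [d d0 fd] := fc _ e0; have [d' d'0 gd] := gc _ e'0.
exists (Num.min d d') => [|x y xy]; first by rewrite lt_min d0.
by split; [apply: fd|apply: gd]; apply: E_le xy; rewrite ge_min lexx ?orbT.
Qed.

Lemma controlledD f g : controlled f -> controlled g ->
  controlled (fun x => f x + g x).
Proof.
move=> fc gc e e0; have e20 : 0 < e / 2 by lra.
have [d d0 dP] := controlled2 fc gc e20 e20.
exists d => // x y /dP[fxy gxy].
by rewrite (splitr e) opprD addrACA; exact: opboundD.
Qed.

Lemma controlledZ (a : C) f : controlled f -> controlled (fun x => a *: f x).
Proof.
move=> fc e e0; have a0 : 0 < normc a + 1 by rewrite ltr_wpDl ?normc_ge0.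
have [|d d0 fd] := fc (e / (normc a + 1)); first by rewrite divr_gt0.
exists d => // x y /fd /(opboundZ a); rewrite scalerBr; apply: opbound_le.
by rewrite mulrCA ger_pMr // ler_pdivrMr // mul1r lerDl.
Qed.

(** The product rule for differences, where each increment is multiplied by a bounded factor. *)
Lemma controlledM f g c d : 0 <= c -> bounded_by f c -> 0 <= d -> bounded_by g d ->
  controlled f -> controlled g -> controlled (fun x => f x * g x).
Proof.
move=> c0 fb d0 gb fc gc e e0.
have cd0 : 0 < c + d + 1 by rewrite ltr_wpDl ?addr_ge0.
have e'0 : 0 < e / (c + d + 1) by rewrite divr_gt0.
have [r r0 rP] := controlled2 fc gc e'0 e'0.
exists r => // x y /rP[fxy gxy].
rewrite (_ : _ - _ = f x * (g x - g y) + (f x - f y) * g y); last first.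
  by rewrite mulrBr mulrBl addrA subrK.
have := opboundD (opboundM c0 (ltW e'0) (fb x) gxy) (opboundM (ltW e'0) d0 fxy (gb y)).
apply: opbound_le; rewrite [_ * d]mulrC -mulrDl mulrCA ger_pMr //.
by rewrite ler_pdivrMr // mul1r lerDl.
Qed.

Lemma controlled_adj f : controlled f -> controlled (fun x => adj (f x)).
Proof.
move=> fc e /fc[d d0 fd]; exists d => // x y /fd.
by rewrite -adjB; exact: opbound_adj.
Qed.

(** The three-epsilon argument; it gives closedness under uniform limits. *)
Lemma controlled_lim f :
  (forall e, 0 < e -> exists2 g, controlled g & forall x, opbound e (g x - f x)) ->
  controlled f.
Proof.
move=> fg e e0; have e30 : 0 < e / 3 by lra.
have [g gc gf] := fg _ e30; have [d d0 gd] := gc _ e30.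
exists d => // x y /gd gxy; have := opboundD (opboundB gxy (gf x)) (gf y).
rewrite (_ : e / 3 + _ + _ = e); last by lra.
congr (opbound e _).
by rewrite opprB (addrC (_ - _) (f x - _)) !addrA !subrK.
Qed.
End ControlledContinuity.

Section UniformlyContinuousFunctions.
Variables (R : realType) (n : nat).
Local Notation C := R[i].
Local Notation X := ('I_n -> R).
Implicit Types f g : X -> 'M[C]_2.

Definition close (d : R) (x y : X) := forall i, `|x i - y i| <= d.

Lemma close_le d d' x y : d <= d' -> close d x y -> close d' x y.
Proof. by move=> dd' xy i; exact: le_trans (xy i) dd'. Qed.

Definition buc : {pred X -> 'M[C]_2} :=
  fun f => `[< (exists2 c, 0 <= c & bounded_by f c) /\ controlled close f >].

Lemma bucP f :
  reflect ((exists2 c, 0 <= c & bounded_by f c) /\ controlled close f) (f \in buc).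
Proof. exact: asboolP. Qed.

Lemma buc_subalg : subalg_closed buc.
Proof.
split=> [|a f g /bucP[[c c0 fc] fu] /bucP[[d d0 gd] gu]
         |f g /bucP[[c c0 fc] fu] /bucP[[d d0 gd] gu]]; apply/bucP; split.
- by exists 1 => // x; exact: opbound1.
- exact: controlled_cst.
- exists (normc a * c + d); first by rewrite addr_ge0 ?mulr_ge0 ?normc_ge0.
  by move=> x; apply: opboundD; [exact: opboundZ|].
- by apply: (controlledD close_le) => //; exact: controlledZ.
- by exists (c * d); [rewrite mulr_ge0|move=> x; apply: opboundM].
- exact: (controlledM close_le c0 fc d0 gd).
Qed.

HB.instance Definition _ := GRing.isSubalgClosed.Build C (X -> 'M[C]_2) buc buc_subalg.

Record bucfun := BUC { bucval :> X -> 'M[C]_2; bucvalP : bucval \in buc }.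
HB.instance Definition _ := [isSub for bucval].
HB.instance Definition _ := [Choice of bucfun by <:].
HB.instance Definition _ := [SubChoice_isSubAlgebra of bucfun by <:].
End UniformlyContinuousFunctions.

Lemma real_complete (R : realType) (a : nat -> R) :
  (forall e, 0 < e -> exists N, forall m n, (N <= m)%N -> (N <= n)%N ->
     `|a m - a n| < e) ->
  exists l, forall e, 0 < e -> exists N, forall n, (N <= n)%N -> `|a n - l| < e.
Proof.
move=> aC; have /cauchy_cvgP/cvg_ex[l al] : cauchy (a n @[n --> \oo]).
  apply/cauchy_exP => e e0; have [N aN] := aC _ e0; exists (a N).
  by exists N => // k /= Nk; apply: aN.
exists l => e e0; have /cvgrPdist_lt/(_ _ e0)[N _ aN] := al.
by exists N => k Nk; rewrite distrC; exact: aN.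
Qed.

Lemma normc_complete (R : realType) (z : nat -> R[i]) :
  (forall e, 0 < e -> exists N, forall m n, (N <= m)%N -> (N <= n)%N ->
     normc (z m - z n) < e) ->
  exists l, forall e, 0 < e -> exists N, forall n, (N <= n)%N -> normc (z n - l) < e.
Proof.
move=> zC.
have [|a za] := @real_complete R (fun n => complex.Re (z n)).
  move=> e /zC[N zN]; exists N => m k Nm Nk; apply: le_lt_trans (zN _ _ Nm Nk).
  by rewrite -raddfB le_normc_Re.
have [|b zb] := @real_complete R (fun n => complex.Im (z n)).
  move=> e /zC[N zN]; exists N => m k Nm Nk; apply: le_lt_trans (zN _ _ Nm Nk).
  by rewrite -raddfB le_normc_Im.
exists (a +i* b)%C => e e0; have e20 : 0 < e / 2 by lra.
have [N zN] := za _ e20; have [M zM] := zb _ e20.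
exists (maxn N M) => k; rewrite geq_max => /andP[Nk Mk].
apply: le_lt_trans (normc_le_ReIm _) _.
have := zN k Nk; have := zM k Mk; case: (z k) => /= x y; lra.
Qed.

(** * The C*-norm on matrix-valued functions and its completeness *)

Section CStar.
Variables (R : realType) (n : nat).
Local Notation C := R[i].
Local Notation X := ('I_n -> R).
Local Notation B := (bucfun R n).
Implicit Types f g : B.

(** This is the supremum over all points of the operator norms of the values. *)
Definition bnorm f : R := inf [set c | 0 <= c /\ bounded_by f c].

Lemma has_inf_bnorm f : has_inf [set c | 0 <= c /\ bounded_by f c].
Proof.
split; last by exists 0 => c [].
by have /bucP[[c c0 fc] _] := bucvalP f; exists c.
Qed.

Lemma bnorm_ge0 f : 0 <= bnorm f.
Proof. by apply: lb_le_inf; [exact: (has_inf_bnorm f).1|move=> c []]. Qed.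

Lemma bnorm_le f c : 0 <= c -> bounded_by f c -> bnorm f <= c.
Proof. by move=> c0 fc; apply: ge_inf; [exact: (has_inf_bnorm f).2|]. Qed.

Lemma bnorm_bound f : bounded_by f (bnorm f).
Proof.
move=> x; apply: opbound_small => d d0.
have [c [c0 fc] cd] := inf_adherent d0 (has_inf_bnorm f).
exact: opbound_le (ltW cd) (fc x).
Qed.

Lemma bucvalD f g x : (f + g) x = f x + g x. Proof. by []. Qed.
Lemma bucvalN f x : (- f) x = - f x. Proof. by []. Qed.
Lemma bucvalM f g x : (f * g) x = f x * g x. Proof. by []. Qed.
Lemma bucvalZ (a : C) f x : (a *: f) x = a *: f x. Proof. by []. Qed.

Lemma bstar_subproof f : (fun x => adj (f x)) \in @buc R n.
Proof.
have /bucP[[c c0 fc] fu] := bucvalP f; apply/bucP; split.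
  by exists c => // x; exact: opbound_adj.
exact: controlled_adj.
Qed.

Definition bstar f : B := BUC (bstar_subproof f).

Lemma bucfunP f g : (forall x, f x = g x) -> f = g.
Proof. by move=> fg; apply/val_inj/funext. Qed.

Lemma bstarK f : bstar (bstar f) = f.
Proof. by apply: bucfunP => x /=; rewrite adjK. Qed.

Lemma bstarD f g : bstar (f + g) = bstar f + bstar g.
Proof. by apply: bucfunP => x; rewrite bucvalD /= -adjD. Qed.

Lemma bstarZ (a : C) f : bstar (a *: f) = a^* *: bstar f.
Proof. by apply: bucfunP => x; rewrite bucvalZ /= -adjZ. Qed.

Lemma bstarM f g : bstar (f * g) = bstar g * bstar f.
Proof. by apply: bucfunP => x; rewrite bucvalM /= -[RHS]adjM. Qed.

Lemma bnorm0_eq0 f : bnorm f = 0 -> f = 0.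
Proof.
move=> f0; apply: bucfunP => x; apply/matrixP => i j; rewrite mxE.
apply: eq0_normc; apply: le_anti; rewrite normc_ge0 andbT -f0.
exact: opbound_entry (bnorm_bound f x).
Qed.

Lemma bnormD f g : bnorm (f + g) <= bnorm f + bnorm g.
Proof.
apply: bnorm_le => [|x]; first by rewrite addr_ge0 ?bnorm_ge0.
by apply: opboundD; exact: bnorm_bound.
Qed.

Lemma bnormZ_le (a : C) f : bnorm (a *: f) <= normc a * bnorm f.
Proof.
apply: bnorm_le => [|x]; first by rewrite mulr_ge0 ?bnorm_ge0 ?normc_ge0.
by apply: opboundZ; exact: bnorm_bound.
Qed.

(** The reverse inequality is [bnormZ_le] for the scalar [a^-1]. *)
Lemma bnormZ (a : C) f : bnorm (a *: f) = normc a * bnorm f.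
Proof.
apply/le_anti; rewrite bnormZ_le /=.
have [->|a0] := eqVneq a 0; first by rewrite normc0 mul0r bnorm_ge0.
have na0 : 0 < normc a.
  by rewrite lt_def normc_ge0 andbT; apply: contra a0 => /eqP/eq0_normc ->.
have := bnormZ_le a^-1 (a *: f).
by rewrite scalerA mulVf // scale1r normcV mulrC ler_pdivlMr // mulrC.
Qed.

Lemma bnormM f g : bnorm (f * g) <= bnorm f * bnorm g.
Proof.
apply: bnorm_le => [|x]; first by rewrite mulr_ge0 ?bnorm_ge0.
by apply: opboundM; rewrite ?bnorm_ge0 //; exact: bnorm_bound.
Qed.

Lemma bnorm_star f : bnorm (bstar f * f) = bnorm f ^+ 2.
Proof.
apply/le_anti/andP; split.
  apply: bnorm_le => [|x]; first by rewrite sqr_ge0.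
  rewrite expr2; apply: opboundM; rewrite ?bnorm_ge0 //; last exact: bnorm_bound.
  by apply: opbound_adj; exact: bnorm_bound.
have le_sqrt : bnorm f <= Num.sqrt (bnorm (bstar f * f)).
  apply: bnorm_le => [|x]; first exact: sqrtr_ge0.
  by apply: opbound_sqrt; [exact: bnorm_ge0|exact: (bnorm_bound (bstar f * f) x)].
have := ler_pM (bnorm_ge0 f) (bnorm_ge0 f) le_sqrt le_sqrt.
by rewrite -!expr2 sqr_sqrtr ?bnorm_ge0.
Qed.

Lemma bnorm_complete (s : nat -> B) :
  (forall e : R, 0 < e -> exists N : nat, forall m n : nat,
     (N <= m)%N -> (N <= n)%N -> bnorm (s m - s n) < e) ->
  exists l : B, bnorm (s n - l) @[n --> \oo] --> (0 : R).
Proof.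
move=> sC.
have /choice[l lP] : forall p : X * ('I_2 * 'I_2), exists l : C,
    forall e, 0 < e -> exists N, forall m, (N <= m)%N ->
      normc (s m p.1 p.2.1 p.2.2 - l) < e.
  case=> x [i j]; apply: normc_complete => e /sC[N sN]; exists N => m k Nm Nk /=.
  apply: le_lt_trans (sN _ _ Nm Nk).
  have := opbound_entry i j (bnorm_bound (s m - s k) x).
  by rewrite bucvalD bucvalN !mxE.
pose L (x : X) : 'M[C]_2 := \matrix_(i, j) l (x, (i, j)).
have sL x e : 0 < e -> exists N, forall m, (N <= m)%N -> opbound e (s m x - L x).
  move=> e0; have e40 : 0 < e / 4 by lra.
  have H i j : exists N, forall m, (N <= m)%N -> normc (s m x i j - l (x, (i, j))) < e / 4.
    exact: lP (x, (i, j)) _ e40.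
  have /choice[N NP] : forall p : 'I_2 * 'I_2, exists N, forall m, (N <= m)%N ->
     normc (s m x p.1 p.2 - l (x, (p.1, p.2))) < e / 4 by move=> p; exact: H.
  exists (\max_p N p) => m Nm; rewrite (_ : e = 4 * (e / 4)); last by lra.
  apply: entry_opbound => i j; rewrite !mxE; apply/ltW/(NP (i, j)).
  by apply: leq_trans Nm; exact: leq_bigmax.
(* The index beyond which [s] is [d]-close to [L] depends on [x], but it serves only for an
   intermediate term, and [d] is arbitrary; so [N] is uniform in [x]. *)
have sLu e : 0 < e -> exists N, forall m, (N <= m)%N -> forall x, opbound e (s m x - L x).
  move=> /sC[N sN]; exists N => m Nm x; apply: opbound_small => d /(sL x)[N' sN'].
  have {}sN' := sN' (maxn N N') (leq_maxr _ _).
  have {}sN := sN m (maxn N N') Nm (leq_maxl _ _).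
  have := opboundD (bnorm_bound (s m - s (maxn N N')) x) sN'.
  by rewrite bucvalD bucvalN addrA subrK; apply: opbound_le; rewrite lerD2r ltW.
have Lbuc : L \in @buc R n.
  apply/bucP; split.
    have [N /(_ _ (leqnn N)) sN] := sLu 1 ltr01.
    exists (bnorm (s N) + 1); first by rewrite addr_ge0 ?bnorm_ge0.
    move=> x; have := opboundB (bnorm_bound (s N) x) (sN x).
    by rewrite subKr.
  apply: controlled_lim => e /sLu[N /(_ _ (leqnn N)) sN].
  by exists (s N) => //; have /bucP[] := bucvalP (s N).
exists (BUC Lbuc); apply/cvgrPdist_le => e e0.
have [N sN] := sLu _ e0; exists N => // m /= Nm.
rewrite sub0r normrN ger0_norm ?bnorm_ge0 //.
by apply: bnorm_le => [|x]; [exact: ltW|exact: sN].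
Qed.

HB.instance Definition _ := isCStarAlgebra.Build R B bstarK bstarD bstarZ bstarM
  bnorm0_eq0 bnormD bnormZ bnormM bnorm_star bnorm_complete.
End CStar.

(** * Continuity of homomorphisms to 2 x 2 matrices *)

Section CStarTheory.
Variables (R : realType) (A : cstarAlgType R).
Implicit Types x y : A.

Lemma cnorm0 : cnorm (0 : A) = 0.
Proof. by rewrite -(scale0r (0 : A)) cnormZ normc0 mul0r. Qed.

Lemma cnormN x : cnorm (- x) = cnorm x.
Proof. by rewrite -scaleN1r cnormZ normcN normc1 mul1r. Qed.

Lemma cnorm_ge0 x : 0 <= cnorm x.
Proof. by have := cnormD x (- x); rewrite subrr cnorm0 cnormN; lra. Qed.

Lemma cnormBC x y : cnorm (x - y) = cnorm (y - x).
Proof. by rewrite -cnormN opprB. Qed.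

Lemma star1 : star (1 : A) = 1.
Proof. by have := starM (star (1 : A)) 1; rewrite mulr1 starK mulr1 => <-. Qed.

Lemma cnormX x k : cnorm (x ^+ k) <= cnorm (1 : A) * cnorm x ^+ k.
Proof.
elim: k => [|k IH]; first by rewrite !expr0 mulr1.
rewrite !exprSr mulrA; apply: le_trans (cnormM _ _) _.
by rewrite ler_wpM2r ?cnorm_ge0.
Qed.

(** The geometric series estimate with denominators cleared, so that induction on [p] is an
    identity. *)
Lemma neumann_partial x k p : cnorm x < 1 ->
  cnorm (\sum_(i < k + p) x ^+ i - \sum_(i < k) x ^+ i) * (1 - cnorm x) <=
  cnorm (1 : A) * cnorm x ^+ k * (1 - cnorm x ^+ p).
Proof.
move=> x1; elim: p => [|p IH].
  by rewrite addn0 subrr cnorm0 expr0 subrr mulr0 mul0r.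
rewrite addnS big_ord_recr /= addrAC.
have h1 : 0 <= 1 - cnorm x by lra.
apply: le_trans (ler_wpM2r h1 (cnormD _ _)) _; rewrite mulrDl.
have h2 := ler_wpM2r h1 (cnormX x (k + p)).
apply: le_trans (lerD IH h2) _.
by rewrite exprD exprS le_eqVlt; apply/orP; left; apply/eqP; ring.
Qed.

(** The partial sums satisfy [(1 - x) * s k = 1 - x ^+ k], and they converge by completeness. *)
Lemma neumann x : cnorm x < 1 -> exists y, (1 - x) * y = 1.
Proof.
move=> x1; pose s k := \sum_(i < k) x ^+ i.
have h0 : 0 < 1 - cnorm x by lra.
have x0 := cnorm_ge0 x.
have pow0 (e : R) : 0 < e -> exists N, forall k, (N <= k)%N ->
    cnorm (1 : A) * cnorm x ^+ k < e.
  move=> e0; have c0 : 0 < cnorm (1 : A) + 1 by rewrite ltr_wpDl ?cnorm_ge0.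
  have := @cvg_expr R (cnorm x); rewrite ger0_norm // => /(_ x1)/cvgrPdist_lt.
  move=> /(_ (e / (cnorm (1 : A) + 1)))[|N _ NP]; first by rewrite divr_gt0.
  exists N => k /NP /=; rewrite sub0r normrN ger0_norm ?exprn_ge0 // ltr_pdivlMr //.
  by apply: le_lt_trans; rewrite mulrC ler_wpM2l ?exprn_ge0 // lerDl.
have sC (e : R) : 0 < e -> exists N : nat, forall m k : nat,
    (N <= m)%N -> (N <= k)%N -> cnorm (s m - s k) < e.
  move=> e0; have [|N NP] := pow0 (e * (1 - cnorm x)); first by rewrite mulr_gt0.
  exists N; have H k m : (N <= k)%N -> (k <= m)%N -> cnorm (s m - s k) < e.
    move=> Nk /subnKC <-; rewrite -(ltr_pM2r h0).
    apply: le_lt_trans (neumann_partial _ _ x1) (le_lt_trans _ (NP _ Nk)).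
    by rewrite ler_piMr ?mulr_ge0 ?exprn_ge0 ?cnorm_ge0 // gerBl exprn_ge0.
  move=> m k Nm Nk; case/orP: (leq_total m k) => mk; last exact: H.
  by rewrite cnormBC; exact: H.
have [y sy] := cnorm_complete s sC.
exists y; apply/eqP; rewrite -subr_eq0; apply/eqP/cnorm0_eq0/le_anti.
rewrite cnorm_ge0 andbT; apply/ler_addgt0Pr => e e0; rewrite add0r.
have c0 : 0 < cnorm (1 - x) + 1 by rewrite ltr_wpDl ?cnorm_ge0.
have [|N NP] := pow0 (e / 2); first by rewrite divr_gt0.
move/cvgrPdist_lt: sy => /(_ (e / 2 / (cnorm (1 - x) + 1)))[|M _ MP].
  by rewrite !divr_gt0.
pose k := maxn N M.
have := MP k (leq_maxr _ _); rewrite /= sub0r normrN ger0_norm ?cnorm_ge0 //.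
rewrite ltr_pdivlMr // => sk.
have sE : (1 - x) * s k = 1 - x ^+ k.
  by rewrite -[RHS]opprB subrX1 -mulNr opprB.
rewrite (_ : _ - 1 = - ((1 - x) * (s k - y)) - x ^+ k); last first.
  by rewrite mulrBr sE !opprB -addrA [_ - 1 - _]addrAC subrr sub0r.
apply: le_trans (cnormD _ _) _; rewrite !cnormN (splitr e); apply: lerD.
  apply: le_trans (cnormM _ _) _; apply: le_trans (ltW sk).
  by rewrite mulrC ler_wpM2l ?cnorm_ge0 // lerDl.
by apply: le_trans (cnormX _ _) _; rewrite ltW // NP // leq_maxl.
Qed.
End CStarTheory.

Lemma det_mx22 (K : comPzRingType) (M : 'M[K]_2) :
  \det M = M 0 0 * M 1 1 - M 0 1 * M 1 0.
Proof.
have lift1 : lift ord0 ord0 = 1 :> 'I_2 by exact/val_inj.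
have lift0 : lift 1 0 = 0 :> 'I_2 by exact/val_inj.
rewrite (expand_det_row _ 0) !big_ord_recl big_ord0 /cofactor !det_mx11 !mxE /=.
rewrite !lift1 lift0 addr0 expr0 mul1r expr1 mulN1r mulrN.
by congr (_ * M _ _ - M _ _ * M _ _).
Qed.

(* If [||h|| < mu] then [mu - h] is invertible by the
   Neumann series, so [mu] is not an eigenvalue of the image of [h = b^* b]. *)
Lemma star_hom_bound (R : realType) (A : cstarAlgType R) (psi : A -> 'M[R[i]]_2) :
  psi 1 = 1 -> (forall x y, psi (x - y) = psi x - psi y) ->
  (forall (a : R[i]) x, psi (a *: x) = a *: psi x) ->
  (forall x y, psi (x * y) = psi x * psi y) ->
  (forall x, psi (star x) = adj (psi x)) ->
  forall b, opbound (8 * cnorm b) (psi b).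
Proof.
move=> psi1 psiB psiZ psiM psis b.
set M := psi b; set h := star b * b.
have lift1 : lift ord0 ord0 = 1 :> 'I_2 by exact/val_inj.
(* [p] and [q] are the diagonal entries of [H], so [p + q] is both its trace and the sum of the
   squared moduli of the entries of [M]. *)
pose p := normc (M 0 0) ^+ 2 + normc (M 1 0) ^+ 2.
pose q := normc (M 0 1) ^+ 2 + normc (M 1 1) ^+ 2.
pose H := adj M * M; pose z := H 0 1; have zE : H 0 1 = z by [].

have HE i j : H i j = (M 0 i)^* * M 0 j + (M 1 i)^* * M 1 j.
  by rewrite /H !mxE !big_ord_recl big_ord0 addr0 !mxE !lift1.
have H00 : H 0 0 = p%:C%C by rewrite HE !mul_conj_normc -rmorphD.
have H11 : H 1 1 = q%:C%C by rewrite HE !mul_conj_normc -rmorphD.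
have H10 : H 1 0 = z^*.
  by rewrite /z !HE rmorphD !rmorphM /= !conjCK; congr (_ + _); rewrite mulrC.
have pq : p + q <= 2 * cnorm b ^+ 2.
  rewrite leNgt; apply/negP => lt_pq.
  pose D := Num.sqrt ((p - q) ^+ 2 + 4 * normc z ^+ 2).
  (* The larger eigenvalue of [H]; it is at least half the trace, hence exceeds [cnorm h]. *)
  pose mu := (p + q + D) / 2.
  have D0 : 0 <= D := sqrtr_ge0 _.
  have muP : (mu - p) * (mu - q) = normc z ^+ 2.
    have DD : D ^+ 2 = (p - q) ^+ 2 + 4 * normc z ^+ 2.
      rewrite sqr_sqrtr //; apply: addr_ge0; rewrite ?sqr_ge0 // mulr_ge0 ?sqr_ge0 //. 
    have -> : (mu - p) * (mu - q) = (D ^+ 2 - (p - q) ^+ 2) / 4 by rewrite /mu; field.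
    by rewrite DD; field.
  have hmu : cnorm h < mu by rewrite cnorm_star /mu; lra.
  have mu0 : 0 < mu := le_lt_trans (cnorm_ge0 h) hmu.
  have muC : mu%:C%C != 0 :> R[i] by rewrite eq_complex /= gt_eqF.
  have [|y hy] := @neumann R A ((mu%:C%C)^-1 *: h).
    by rewrite cnormZ normcV normcr (gtr0_norm mu0) mulrC ltr_pdivrMr // mul1r.
  have := congr1 psi hy; rewrite psiM psiB psiZ psi1 psiM psis -/M -/H.
  clear hmu hy; clearbody H z.
  (* Determinants of [(mu - H) * psi y = mu] give [0 = mu ^+ 2], a contradiction. *)
  move=> /(congr1 (fun N : 'M[R[i]]_2 => mu%:C%C *: N)).
  rewrite scalerAl scalerBr scalerA divff // scale1r => /(congr1 determinant).
  rewrite -[_ * psi y]/(_ *m psi y) det_mulmx detZ det1 mulr1 det_mx22 !mxE.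
  rewrite H00 H11 H10 zE /= mulr1n !mulr0n !mulr1 !mulr0 !sub0r mulrNN.
  rewrite -!rmorphB -rmorphM /= muP [z * _]mulrC mul_conj_normc subrr mul0r.
  by move/esym/eqP; rewrite expf_eq0 (negPf muC) andbF.
have b0 := cnorm_ge0 b.
(* Each squared entry is at most [2 * cnorm b ^+ 2], so each entry is at most [2 * cnorm b];
   [entry_opbound] costs the factor 4. *)
rewrite (_ : 8 * _ = 4 * (2 * cnorm b)); last by ring.
apply: entry_opbound => i j; have Mij : normc (M i j) ^+ 2 <= p + q.
  have [s00 s01] := (sqr_ge0 (normc (M 0 0)), sqr_ge0 (normc (M 0 1))).
  have [s10 s11] := (sqr_ge0 (normc (M 1 0)), sqr_ge0 (normc (M 1 1))).
  have ord2 (k : 'I_2) : k = 0 \/ k = 1.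
    by case: k => -[|[|//]] h2; [left|right]; exact/val_inj.
  by rewrite /p /q; case: (ord2 i) => ->; case: (ord2 j) => ->; lra.
rewrite -[leLHS]ger0_norm ?normc_ge0 // -[leRHS]ger0_norm; last by rewrite mulr_ge0.
by rewrite -!sqrtr_sqr ler_wsqrtr //; nra.
Qed.

(** * Representations by reflections *)

Section UnitaryGroup.
Variables (R : realType) (A : cstarAlgType R).

Definition is_unitary : {pred A} := fun x => (star x * x == 1) && (x * star x == 1).

(** Made into a group so that it can be the target in the universal property of the free product. *)
Record unitary := Unitary { uval : A; uvalP : is_unitary uval }.
HB.instance Definition _ := [isSub for uval].
HB.instance Definition _ := [Choice of unitary by <:].
Implicit Types x y : unitary.

Lemma star_mul x : star (uval x) * uval x = 1.
Proof. by have /andP[/eqP] := uvalP x. Qed.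

Lemma mul_star x : uval x * star (uval x) = 1.
Proof. by have /andP[_ /eqP] := uvalP x. Qed.

Lemma unitary_one_subproof : is_unitary 1.
Proof. by rewrite /is_unitary star1 mulr1 eqxx. Qed.

Lemma unitary_mul_subproof x y : is_unitary (uval x * uval y).
Proof.
apply/andP; rewrite starM mulrA -(mulrA (star _)) star_mul mulr1 star_mul.
by rewrite mulrA -(mulrA (uval x)) mul_star mulr1 mul_star.
Qed.

Lemma unitary_inv_subproof x : is_unitary (star (uval x)).
Proof. by apply/andP; rewrite starK star_mul mul_star. Qed.

Definition unitary_one := Unitary unitary_one_subproof.
Definition unitary_mul x y := Unitary (unitary_mul_subproof x y).
Definition unitary_inv x := Unitary (unitary_inv_subproof x).

Let mulA : associative unitary_mul.
Proof. by move=> x y z; apply: val_inj; rewrite /= mulrA. Qed.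
Let mul1 : left_id unitary_one unitary_mul.
Proof. by move=> x; apply: val_inj; rewrite /= mul1r. Qed.
Let mulr1 : right_id unitary_one unitary_mul.
Proof. by move=> x; apply: val_inj; rewrite /= mulr1. Qed.
Let mulV : left_inverse unitary_one unitary_inv unitary_mul.
Proof. by move=> x; apply: val_inj; rewrite /= star_mul. Qed.
Let mulrV : right_inverse unitary_one unitary_inv unitary_mul.
Proof. by move=> x; apply: val_inj; rewrite /= mul_star. Qed.

HB.instance Definition _ := isGroup.Build unitary mulA mul1 mulr1 mulV mulrV.
End UnitaryGroup.

Section Involution.
Variables (G : groupType) (w : G) (ww : (w * w = 1)%g).

(* The proof argument is what the morphism instance below is inferred from. *)
Definition involution_hom of (w * w = 1)%g :=
  fun k : 'Z_2 => if k == 0 then 1%g else w.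

Let involution_hom_morph : (involution_hom ww 1%g = 1%g) *
  {morph involution_hom ww : x y / (x * y)%g}.
Proof.
split=> [//|]; rewrite /involution_hom => -[[|[|//]] i] -[[|[|//]] j] /=;
  by rewrite ?mulg1 ?mul1g ?ww.
Qed.

HB.instance Definition _ :=
  isUMagmaMorphism.Build 'Z_2 G (involution_hom ww) involution_hom_morph.
End Involution.

(** * Reflections of the plane *)

Section Reflection.
Variable R : realType.
Implicit Types s t : R.
Local Notation C := R[i].

(* Rational parametrization: [refl_cos] and [refl_sin] are the cosine and sine of
   twice the arctangent of [t]. *)
Definition refl_cos t := (1 - t ^+ 2) / (1 + t ^+ 2).
Definition refl_sin t := 2 * t / (1 + t ^+ 2).

(** The reflection in the line of slope [t]. *)
Definition refl t : 'M[C]_2 := \matrix_(i, j)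
  (if i != j then refl_sin t else if i == 0 then refl_cos t else - refl_cos t)%:C%C.

Let den_gt0 t : 0 < 1 + t ^+ 2.
Proof. by rewrite ltr_wpDr ?sqr_ge0. Qed.

Lemma refl_cos_sin t : refl_cos t ^+ 2 + refl_sin t ^+ 2 = 1.
Proof.
have := den_gt0 t; rewrite /refl_cos /refl_sin => /lt0r_neq0 t0.
by field.
Qed.

(** A factor [t - s] splits off, and the cofactor is bounded because twice the modulus of a real is
    at most 1 plus its square. *)
Lemma refl_cos_lip s t : `|refl_cos s - refl_cos t| <= 2 * `|s - t|.
Proof.
have := den_gt0 s; have := den_gt0 t => t0 s0.
have -> : refl_cos s - refl_cos t =
    (t - s) * (2 * (t + s) / ((1 + s ^+ 2) * (1 + t ^+ 2))).
  by rewrite /refl_cos; field; rewrite !gt_eqF.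
rewrite normrM distrC mulrC ler_wpM2r // normrM normfV.
rewrite [X in _ / X]gtr0_norm ?mulr_gt0 // ler_pdivrMr ?mulr_gt0 //.
have := sqr_ge0 (s * t); have := sqr_ge0 s; have := sqr_ge0 t.
have := sqr_ge0 (s - 1); have := sqr_ge0 (s + 1).
have := sqr_ge0 (t - 1); have := sqr_ge0 (t + 1).
by move=> *; rewrite ler_norml; apply/andP; split; lra.
Qed.

Lemma refl_sin_lip s t : `|refl_sin s - refl_sin t| <= 2 * `|s - t|.
Proof.
have := den_gt0 s; have := den_gt0 t => t0 s0.
have -> : refl_sin s - refl_sin t =
    (s - t) * (2 * (1 - s * t) / ((1 + s ^+ 2) * (1 + t ^+ 2))).
  by rewrite /refl_sin; field; rewrite !gt_eqF.
rewrite normrM mulrC ler_wpM2r // normrM normfV.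
rewrite [X in _ / X]gtr0_norm ?mulr_gt0 // ler_pdivrMr ?mulr_gt0 //.
have := sqr_ge0 (s * t); have := sqr_ge0 s; have := sqr_ge0 t.
have := sqr_ge0 (s - t); have := sqr_ge0 (s + t).
by move=> *; rewrite ler_norml; apply/andP; split; lra.
Qed.

Lemma adj_refl t : adj (refl t) = refl t.
Proof.
apply/matrixP => i j; rewrite !mxE eq_sym.
have conjr (a : R) : (a%:C%C : C)^* = a%:C%C.
  by apply/eqP; rewrite eq_complex /= oppr0 !eqxx.
by rewrite conjr; case: (eqVneq i j) => [->|].
Qed.

Lemma refl_sqr t : refl t * refl t = 1.
Proof.
have cs := refl_cos_sin t.
apply/matrixP => i j; rewrite !mxE !big_ord_recl big_ord0 addr0 !mxE -!rmorphM -rmorphD /=.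
case: i => -[|[|//]] hi; case: j => -[|[|//]] hj /=; apply/eqP;
  rewrite eq_complex /= ?mulr1n ?mulr0n eqxx andbT; apply/eqP; lra.
Qed.

Lemma refl_lip s t : opbound (8 * `|s - t|) (refl s - refl t).
Proof.
rewrite (_ : 8 * _ = 4 * (2 * `|s - t|)); last by ring.
apply: entry_opbound => i j; rewrite !mxE -rmorphB normcr.
case: ifP => _; first exact: refl_sin_lip.
case: ifP => _; first exact: refl_cos_lip.
by rewrite -opprD normrN; exact: refl_cos_lip.
Qed.

Lemma refl_bound t : opbound 1 (refl t).
Proof.
rewrite -sqrtr1; apply: opbound_sqrt => //.
by rewrite adj_refl refl_sqr; exact: opbound1.
Qed.
End Reflection.

(** * Single generation *)

Section HomToFunctions.
Variables (R : realType) (n : nat) (A : cstarAlgType R).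
Variables (phi : {lrmorphism A -> bucfun R n}) (phiS : star_preserving phi).

Lemma phi_bound b : bounded_by (phi b) (8 * cnorm b).
Proof.
move=> x; apply: (star_hom_bound (psi := fun b => phi b x)) => [|y z|k y|y z|y].
- by rewrite rmorph1.
- by rewrite rmorphB.
- by rewrite linearZ.
- by rewrite rmorphM.
- by rewrite phiS.
Qed.

(** This carries control from a generator to the whole algebra. Closedness under limits rests on
    [phi_bound], whence the [e / 8]. *)
Lemma controlled_csub (E : R -> ('I_n -> R) -> ('I_n -> R) -> Prop) :
  (forall d d' x y, d <= d' -> E d x y -> E d' x y) ->
  unital_cstar_subalgebra [set b | controlled E (phi b)].
Proof.
move=> E_le; have cb0 (b : A) : 0 <= 8 * cnorm b by rewrite mulr_ge0 ?cnorm_ge0.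
split=> [s l sS sl||x y xS yS|k x xS|x y xS yS|x xS] /=.
- apply: controlled_lim => e e0.
  move/cvgrPdist_lt: sl => /(_ (e / 8))[|N _ /(_ _ (leqnn N)) /= sN].
    by rewrite divr_gt0.
  exists (phi (s N)) => [|x]; first exact: sS.
  have := phi_bound (s N - l) x; rewrite rmorphB; apply: opbound_le.
  by move: sN; rewrite sub0r normrN ger0_norm ?cnorm_ge0 // ltr_pdivlMr // mulrC => /ltW.
- by rewrite rmorph1; exact: controlled_cst.
- by rewrite rmorphD; exact: controlledD.
- by rewrite linearZ; exact: controlledZ.
- by rewrite rmorphM; exact: (controlledM E_le (cb0 x) (phi_bound x) (cb0 y) (phi_bound y)).
- by rewrite phiS; exact: controlled_adj.
Qed.
End HomToFunctions.

Section ReflectionFunctions.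
Variables (R : realType) (n : nat) (i : 'I_n).

Lemma refl_fun_subproof : (fun x => refl (x i)) \in @buc R n.
Proof.
apply/bucP; split; first by exists 1 => // x; exact: refl_bound.
move=> e e0; exists (e / 8) => [|x y xy]; first by rewrite divr_gt0.
by apply: opbound_le (refl_lip _ _); rewrite mulrC -ler_pdivlMr.
Qed.

Definition refl_fun : bucfun R n := BUC refl_fun_subproof.

Lemma star_refl_fun : star refl_fun = refl_fun.
Proof. by apply: bucfunP => x; exact: adj_refl. Qed.

Lemma refl_fun_sqr : refl_fun * refl_fun = 1.
Proof. by apply: bucfunP => x; exact: refl_sqr. Qed.

Lemma refl_fun_unitary : is_unitary refl_fun.
Proof. by rewrite /is_unitary star_refl_fun refl_fun_sqr eqxx. Qed.

Definition refl_unitary : unitary (bucfun R n) := Unitary refl_fun_unitary.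

Lemma refl_unitary_sqr : (refl_unitary * refl_unitary = 1)%g.
Proof. by apply: val_inj; exact: refl_fun_sqr. Qed.
End ReflectionFunctions.

Definition coord (R : realType) (M : 'M[R[i]]_2) (j : 'I_2 * 'I_2 * bool) : R :=
  if j.2 then complex.Re (M j.1.1 j.1.2) else complex.Im (M j.1.1 j.1.2).

Lemma coord_bound (R : realType) (e : R) (M : 'M[R[i]]_2) j :
  opbound e M -> `|coord M j| <= e.
Proof.
move=> /(opbound_entry j.1.1 j.1.2); apply: le_trans.
by rewrite /coord; case: j.2; [exact: le_normc_Re|exact: le_normc_Im].
Qed.

Lemma opbound_coord (R : realType) (e : R) (M : 'M[R[i]]_2) :
  (forall j, `|coord M j| <= e) -> opbound (8 * e) M.
Proof.
move=> Me; rewrite (_ : 8 * e = 4 * (e + e)); last by ring.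
apply: entry_opbound => i j; apply: le_trans (normc_le_ReIm _) _.
by apply: lerD; [exact: (Me (i, j, true))|exact: (Me (i, j, false))].
Qed.

Lemma coordB (R : realType) (M N : 'M[R[i]]_2) j :
  coord (M - N) j = coord M j - coord N j.
Proof. by rewrite /coord !mxE; case: j.2; rewrite raddfB. Qed.

(** The upper left entries, the cosines, are 1 and 0. *)
Lemma refl01_far (R : realType) : ~ opbound (1 / 2 : R) (refl 0 - refl 1).
Proof.
move=> /(opbound_entry 0 0); rewrite !mxE -rmorphB normcr /refl_cos /=.
by rewrite expr0n expr1n subrr mul0r !subr0 addr0 divr1 normr1; lra.
Qed.

Lemma refl_not_singly_generated (R : realType) (A : cstarAlgType R)
    (k := #|{: 'I_2 * 'I_2 * bool}|)
    (phi : {lrmorphism A -> bucfun R k.+1}) (w : 'I_k.+1 -> A) :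
  star_preserving phi -> (forall i, phi (w i) = refl_fun R i) -> ~ singly_generated A.
Proof.
move=> phiS phiw [a agen].
pose E d (x y : 'I_k.+1 -> R) := opbound d (phi a x - phi a y).
have E_le d d' x y : d <= d' -> E d x y -> E d' x y by exact: opbound_le.
(* For this [E] the subalgebra of [controlled_csub] contains [a], hence every element of [A]. *)
have ES b : controlled E (phi b).
  have : [set: A] b by [].
  rewrite -agen; apply: (@smallest_sub _ _ _ _ (controlled_csub phiS E_le)).
  by move=> _ -> e e0; exists e.
have half_gt0 : 0 < 1 / 2 :> R by lra.
have /choice[d dP] : forall i, exists d, 0 < d /\ forall x y : 'I_k.+1 -> R,
    E d x y -> opbound (1 / 2) (refl (x i) - refl (y i)).
  move=> i; have [d d0 dP] := ES (w i) _ half_gt0.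
  by exists d; split => // x y /dP; rewrite phiw.
(* One modulus for all coordinates; the default 1 keeps the minimum positive. *)
pose m := \big[Order.min/1]_i d i.
have m0 : 0 < m by apply: lt_bigmin => // i _; exact: (dP i).1.
pose F x (j : 'I_k) := coord (phi a x) (enum_val j).
apply: (@no_uniform_embedding R k F) => [e e0|].
  have /bucP[_ /(_ _ e0)[r r0 rP]] := bucvalP (phi a).
  by exists r => // x y /rP xy j; rewrite -coordB; exact: coord_bound.
(* If the real coordinates of [phi a] at [x] and [y] differ by at most [m / 8], then [opbound_coord]
   makes the matrices [m]-close, so the reflections are within 1/2, which is impossible on opposite
   faces. *)
exists (m / 8) => [|x y xy i xi yi]; first by rewrite divr_gt0.
apply: (@refl01_far R).
suff: opbound (1 / 2) (refl (x i) - refl (y i)) by rewrite xi yi.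
apply: (dP i).2.
apply: (@opbound_le _ (8 * (m / 8))); first by rewrite mulrC divfK // bigmin_le.
by apply: opbound_coord => j; have := xy (enum_rank j); rewrite /F enum_rankK coordB.
Qed.

Theorem corollary1p4 (R : realType) (G : groupType)
    (iota : forall n : nat, UMagmaMorphism.type 'Z_2 G)
    (hG : @is_free_product nat (fun _ => 'Z_2 : groupType) G iota)
    (A : cstarAlgType R) (u : G -> A) (hA : is_full_group_cstar u) :
  ~ singly_generated A.
Proof.
pose k := #|{: 'I_2 * 'I_2 * bool}|; pose B := bucfun R k.+1.
(* [inord] sends every index beyond [k] to 0, so all later generators go to the first reflection. *)
pose W (n : nat) : UMagmaMorphism.type 'Z_2 (unitary B) :=
  involution_hom (refl_unitary_sqr R (inord n : 'I_k.+1)).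
have [Phi [PhiW _]] := hG _ W.
have vrep : unitary_representation (fun g => uval (Phi g)).
  split=> [|g h|g|g].
  - by rewrite gmulf1.
  - by rewrite gmulfM.
  - exact: star_mul.
  - exact: mul_star.
have [phi [phiS phiu _]] := hA.2 B _ vrep.
(* In [iota i 1] the 1 is the ring unit of ['Z_2], that is, the generator and not the identity of
   the group. *)
apply: (@refl_not_singly_generated _ _ phi (fun i => u (iota i 1))) => // i.
have := phiu (iota i 1); have := PhiW i 1 => /= -> ->.
by rewrite /involution_hom /= inord_val.
Qed.
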